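(* Let $G$ be a sum basic equilibrium graph. If $G$ is a cactus graph, then the diameter of $G$ is at most $2$.
   Context: Graphs are finite, simple and undirected. For a graph $G$ and a vertex $u$, let $D_G(u)=\sum_{v\ne u} d_G(u,v)$ if $G$ is connected and $D_G(u)=\infty$ otherwise, where $d_G$ is the graph distance. A deviation (swap) in $u$ replaces an edge $uv\in E(G)$ by $uv'$, where $v'\in V(G)\setminus\{u,v\}$ is any other node; the deviated graph $G'$ is the simple graph with edge set $(E(G)\setminus\{uv\})\cup\{uv'\}$ (so if $uv'$ is already an edge, the swap just deletes $uv$). The cost difference of the deviation is $D_{G'}(u)-D_G(u)$. A graph $G$ is a sum basic equilibrium (also called a sum equilibrium graph in the basic network-creation game) if it is connected and for every vertex $u$ and every deviation in $u$ the cost difference is non-negative. A cactus graph is a connected graph in which any two distinct simple cycles have at most one vertex in common. *)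

(* Defs.v *)
From mathcomp Require Import all_boot all_order all_algebra.
From mathcomp Require Export constructive_ereal.
Set Implicit Arguments.
Unset Strict Implicit.
Unset Printing Implicit Defensive.
Import Order.TTheory GRing.Theory Num.Theory.

(* A graph on the vertex type [T] is given by its edge set. *)
Definition simple_graph (T : finType) (E : {set {set T}}) : Prop :=
  forall a : {set T}, a \in E -> #|a| = 2.

Definition adj (T : finType) (E : {set {set T}}) : rel T :=
  fun x y => [set x; y] \in E.

Definition connected_graph (T : finType) (E : {set {set T}}) : bool :=
  [forall x, forall y, connect (adj E) x y].

Definition has_walk (T : finType) (E : {set {set T}}) (x y : T) (n : nat)
    : bool :=
  [exists p : n.-tuple T, path (adj E) x p && (last x p == y)].

(* The least length of a walk from [x] to [y].  Such a walk, if there is any,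
   can be taken of length less than [#|T|]; see [dist_walk] and [dist_min].
   If there is none, the value is [#|T|]. *)
Definition dist (T : finType) (E : {set {set T}}) (x y : T) : nat :=
  find (has_walk E x y) (iota 0 #|T|).

Definition distance_sum (T : finType) (E : {set {set T}}) (u : T) : \bar int :=
  if connected_graph E then ((\sum_(v | v != u) dist E u v)%:Z)%:E
  else (+oo)%E.

Definition swap (T : finType) (E : {set {set T}}) (u v v' : T)
    : {set {set T}} :=
  (E :\ [set u; v]) :|: [set [set u; v']].

Definition sum_basic_equilibrium (T : finType) (E : {set {set T}}) : Prop :=
  connected_graph E /\
  forall u v v' : T, [set u; v] \in E -> v' != u -> v' != v ->
    (0 <= distance_sum (swap E u v v') u - distance_sum E u)%E.

(* A simple cycle is represented by a cyclic sequence of its vertices; two such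
   sequences represent the same cycle when they have the same edges. *)
Definition simple_cycle (T : finType) (E : {set {set T}}) (c : seq T) : bool :=
  [&& 2 < size c, uniq c & cycle (adj E) c].

Definition cycle_edges (T : finType) (c : seq T) : {set {set T}} :=
  [set [set x; next c x] | x in c].

Definition cactus (T : finType) (E : {set {set T}}) : Prop :=
  connected_graph E /\
  forall c1 c2 : seq T, simple_cycle E c1 -> simple_cycle E c2 ->
    cycle_edges c1 <> cycle_edges c2 ->
    #|[set x in c1] :&: [set x in c2]| <= 1.

Definition diameter (T : finType) (E : {set {set T}}) : nat :=
  \max_(x : T) \max_(y : T) dist E x y.

Lemma has_walkP (T : finType) (E : {set {set T}}) (x y : T) (n : nat) :
  reflect (exists p : seq T, [/\ size p = n, path (adj E) x p & last x p = y])
          (has_walk E x y n).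
Proof.
apply: (iffP existsP) => [[p /andP[pP /eqP pl]] | [p [sp pP pl]]].
  by exists p; rewrite size_tuple.
have sp' : size p == n by apply/eqP.
by exists (Tuple sp'); rewrite /= pP pl eqxx.
Qed.

Lemma dist_min (T : finType) (E : {set {set T}}) (x : T) (p : seq T) :
  path (adj E) x p -> dist E x (last x p) <= size p.
Proof.
move=> pP; rewrite leqNgt; apply/negP => lt_p.
have ltT : size p < #|T|.
  by apply: leq_trans lt_p _; rewrite -[leqRHS](size_iota 0); apply: find_size.
have := before_find 0 lt_p; rewrite nth_iota // add0n.
by case: has_walkP => // -[]; exists p.
Qed.

Lemma dist_walk (T : finType) (E : {set {set T}}) (x y : T) :
  connect (adj E) x y ->
  exists p : seq T, [/\ size p = dist E x y, path (adj E) x p & last x p = y].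
Proof.
case/connectP => p0 pP0 ->; case/shortenP: pP0 => p pP up _.
set y' := last x p; apply/has_walkP.
have ltT : size p < #|T| by have := max_card [in x :: p]; rewrite (card_uniqP up).
have hs : has (has_walk E x y') (iota 0 #|T|).
  apply/hasP; exists (size p); first by rewrite mem_iota.
  by apply/has_walkP; exists p.
have := nth_find 0 hs; rewrite nth_iota ?add0n //.
by rewrite -[ltnRHS](size_iota 0) -has_find.
Qed.

Lemma swap_simple (T : finType) (E : {set {set T}}) (u v v' : T) :
  simple_graph E -> v' != u -> simple_graph (swap E u v v').
Proof.
move=> sE v'u a; rewrite !inE => /orP[/andP[_ /sE] // | /eqP ->].
by rewrite cards2 eq_sym v'u.
Qed.

(* Main.v *)
Require Import Defs.
From mathcomp Require Import all_boot.
From mathcomp Require Import all_order all_algebra.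

Set Implicit Arguments.
Unset Strict Implicit.
Unset Printing Implicit Defensive.
Import Order.TTheory GRing.Theory Num.Theory.

(** Three facts carry the proof.

    - In a cactus, a vertex that is not a cut vertex has degree at most 2
      ([cactus_not_cut_deg2]).

    - In an equilibrium, a shortest path [u, p, a, y] cannot have [p] of
      degree 2: replacing [up] by [ua] shortens the distances from [u] to [a]
      and [y] and lengthens only the one to [p], by one
      ([no_degree2_on_long_path]).

    - In an equilibrium cactus, no vertex other than a median [a], a vertex
      that minimises the sum of distances, is a cut vertex
      ([median_not_cut]).  Otherwise let [b] be the cut vertex farthest from
      [a], and [x] a neighbour of [b] that [b] separates from [a].  The
      vertices that [b] separates from [a] are farther than [b] from [a],
      hence are not cut vertices and have degree at most 2.  By the second
      fact, applied to a path that continues through [b] towards [a], a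
      neighbour of [x] other than [b] is adjacent to [b].  Thus [x] is a leaf
      or lies in a triangle pending at [b].  Unless the distance sum of [b] is
      strictly smaller than that of [a], which is impossible for a median [a],
      replacing [xb] by [xa] profits [x] ([hanging_neighbour_gain]).

    If two vertices were at distance at least 3, a shortest path between them
    would start with [x, p, q, y].  One of [p] and [q] is not the median, so it
    is not a cut vertex, so it has degree 2; the second fact, applied to this
    path or to its reverse, gives a contradiction. *)

(** * Distances *)

Section Distances.

Variables (T : finType) (E : {set {set T}}).

Lemma adj_sym x y : adj E x y = adj E y x.
Proof. by rewrite /adj setUC. Qed.

Lemma adj_neq x y : simple_graph E -> adj E x y -> x != y.
Proof. by move=> sE /sE; rewrite cards2; case: eqP. Qed.

Lemma dist_self x : dist E x x = 0.
Proof. by apply/eqP; rewrite -leqn0; apply: (@dist_min _ E x [::]). Qed.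

Lemma dist_adj x y : adj E x y -> dist E x y <= 1.
Proof. by move=> xy; apply: (@dist_min _ E x [:: y]); rewrite /= xy. Qed.

Hypothesis conE : connected_graph E.

Lemma connected_connect x y : connect (adj E) x y.
Proof. by move/forallP: conE => /(_ x) /forallP. Qed.

Lemma dist_eq0 x y : (dist E x y == 0) = (x == y).
Proof.
apply/eqP/eqP => [d0 | ->]; last exact: dist_self.
have [p [sp _ <-]] := dist_walk (connected_connect x y).
by move: sp; rewrite d0 => /size0nil ->.
Qed.

Lemma distC x y : dist E x y = dist E y x.
Proof.
suff le_dist u v : dist E u v <= dist E v u.
  by apply/eqP; rewrite eqn_leq !le_dist.
have [p [<- pP <-]] := dist_walk (connected_connect v u).
have rP : path (adj E) (last v p) (rev (belast v p)).
  by rewrite rev_path; apply: sub_path pP => a b; rewrite /= adj_sym.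
have := dist_min rP; rewrite size_rev size_belast.
suff -> : last (last v p) (rev (belast v p)) = v by [].
by case: p {pP rP} => //= z p; rewrite rev_cons last_rcons.
Qed.

Lemma dist_walk_uniq x y :
  exists p, [/\ size p = dist E x y, path (adj E) x p, last x p = y
              & uniq (x :: p)].
Proof.
have [p [sp pP lp]] := dist_walk (connected_connect x y).
case: (shortenP pP) lp => q qP uq qp lq; exists q; split=> //.
apply/eqP; rewrite eqn_leq -{2}lq dist_min // andbT -sp.
by apply: uniq_leq_size => //; case/andP: uq.
Qed.

Lemma dist_triangle y x z : dist E x z <= dist E x y + dist E y z.
Proof.
have [p [<- pP lp]] := dist_walk (connected_connect x y).
have [q [<- qP <-]] := dist_walk (connected_connect y z).
by rewrite -size_cat -lp -last_cat; apply: dist_min; rewrite cat_path pP lp.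
Qed.

Lemma dist_split x p z :
  path (adj E) x p -> z \in x :: p ->
  dist E x z + dist E z (last x p) <= size p.
Proof.
move=> + zp; case/splitPl: p / zp => p1 p2 <-; rewrite cat_path => /andP[P1 P2].
by rewrite last_cat size_cat leq_add // dist_min.
Qed.

End Distances.

(** * Effect of a swap *)

Lemma leq_of_cost_difference (m n : nat) :
  (0 <= (m%:Z)%:E - (n%:Z)%:E)%E -> n <= m.
Proof. by rewrite sube_ge0 // lee_fin lez_nat. Qed.

Section Swaps.

Variables (T : finType) (E : {set {set T}}).
Hypothesis sE : simple_graph E.

Lemma adj_swap_new u v v' : adj (swap E u v v') u v'.
Proof. by rewrite /adj !inE eqxx orbT. Qed.

Lemma adj_swap_away u v v' x y :
  adj E x y -> x != u -> y != u -> adj (swap E u v v') x y.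
Proof.
move=> xy xu yu; rewrite /adj !inE -/(adj E x y) xy andbT.
suff -> : [set x; y] != [set u; v] by [].
apply/eqP => /setP /(_ u); rewrite !inE eqxx.
by rewrite ![u == _]eq_sym (negPf xu) (negPf yu).
Qed.

Lemma adj_swap_center u v v' y :
  adj E u y -> y != v -> adj (swap E u v v') u y.
Proof.
move=> uy yv; rewrite /adj !inE -/(adj E u y) uy andbT.
suff -> : [set u; y] != [set u; v] by [].
apply/eqP => /setP /(_ y); rewrite !inE eqxx orbT (negPf yv) eq_sym.
by rewrite (negPf (adj_neq sE uy)).
Qed.

Lemma path_swap_away u v v' x p :
  path (adj E) x p -> u \notin x :: p -> path (adj (swap E u v v')) x p.
Proof.
elim: p x => //= y p IH x /andP[xy pP]; rewrite !inE !negb_or ![u == _]eq_sym.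
case/and3P=> xu yu up; rewrite adj_swap_away //=; apply: IH => //.
by rewrite inE negb_or eq_sym yu.
Qed.

(** In an equilibrium, exhibiting walks after a swap bounds the sum of the
    distances before it; the walks also witness that the deviated graph is
    connected, so that its cost is finite. *)
Lemma equilibrium_swap u v v' (f : T -> nat) :
  sum_basic_equilibrium E -> adj E u v -> v' != u -> v' != v ->
  (forall w, w != u -> exists p,
     [/\ path (adj (swap E u v v')) u p, last u p = w & size p <= f w]) ->
  \sum_(w | w != u) dist E u w <= \sum_(w | w != u) f w.
Proof.
case=> conE eqE uv v'u v'v walks; have := eqE u v v' uv v'u v'v.
have con' : connected_graph (swap E u v v').
  have to w : connect (adj (swap E u v v')) u w.
    have [-> | wu] := eqVneq w u; first exact: connect0.
    by have [p [pP lp _]] := walks w wu; apply/connectP; exists p.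
  apply/forallP => x; apply/forallP => y; apply: connect_trans (to y).
  by rewrite (sym_connect_sym (adj_sym _)).
rewrite /distance_sum conE con' => /leq_of_cost_difference /leq_trans; apply.
apply: leq_sum => w wu; have [p [pP <- le_f]] := walks w wu.
exact: leq_trans (dist_min pP) le_f.
Qed.

Lemma no_degree2_on_long_path u p a y :
  sum_basic_equilibrium E -> adj E u p -> adj E p a -> adj E a y ->
  (forall z, adj E p z -> z = u \/ z = a) -> 2 < dist E u y -> False.
Proof.
move=> eqE up pa ay deg2 duy; have conE := eqE.1.
have [pu ap ya] : [/\ p != u, a != p & y != a].
  by split; rewrite eq_sym; apply: (@adj_neq _ E).
have day := dist_adj ay; have dpa := dist_adj pa; have dup := dist_adj up.
have dua : 1 < dist E u a.
  rewrite -ltnS (leq_trans duy) // (leq_trans (dist_triangle conE a _ _)) //.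
  by rewrite -addn1 leq_add2l.
have au : a != u by apply: contraTneq dua => ->; rewrite dist_self.
have yu : y != u by apply: contraTneq duy => ->; rewrite dist_self.
have yp : y != p.
  by apply: contraTneq duy => ->; rewrite -leqNgt (leq_trans dup).
(* [f] bounds the distances from [u] after the swap. *)
pose f w := if w == p then 2 else if w == a then 1 else if w == y then 2
            else dist E u w.
have walks w : w != u -> exists q,
    [/\ path (adj (swap E u p a)) u q, last u q = w & size q <= f w].
  move=> wu; rewrite /f; have [-> | wp] := eqVneq w p.
    exists [:: a; p]; rewrite /= adj_swap_new /= adj_swap_away //.
    by rewrite adj_sym.
  have [-> | wa] := eqVneq w a; first by exists [:: a]; rewrite /= adj_swap_new.
  have [-> | wy] := eqVneq w y.
    by exists [:: a; y]; rewrite /= adj_swap_new /= adj_swap_away.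
  have [[|z q] [<- /= qP lq uq]] := dist_walk_uniq conE u w.
    by move: wu; rewrite -lq eqxx.
  move: uq qP lq => /= /and3P[uzq _ _] /andP[uz qP] lq.
  (* A shortest walk that starts with [u, p] goes on to [a], and [p] can be
     skipped; any other one does not use the edge [up]. *)
  have [zp | zp] := eqVneq z p; last first.
    by exists (z :: q); rewrite /= adj_swap_center //= path_swap_away.
  case: q => [|t q] in uzq qP lq *; first by move: wp; rewrite -lq /= zp eqxx.
  move: qP => /= /andP[zt qP]; rewrite zp in zt uzq.
  have ta : t = a.
    by case: (deg2 _ zt) => // tu; rewrite tu !inE eqxx orbT in uzq.
  exists (t :: q); rewrite {1}ta /= adj_swap_new -ta path_swap_away //.
  by move: uzq; rewrite inE => /norP[].
have := equilibrium_swap eqE up au ap walks.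
rewrite leqNgt => /negP; apply.
have split3 g : \sum_(w | w != u) g w = g p + g a + g y
    + \sum_(w | (w != u) && (w != p) && (w != a) && (w != y)) g w.
  by rewrite (bigD1 p) //= (bigD1 a) ?au //= (bigD1 y) ?yu ?yp //= !addnA.
rewrite !split3.
rewrite (eq_bigr (dist E u)); last first.
  move=> w /andP[/andP[/andP[_ wp] wa] wy].
  by rewrite /f (negPf wp) (negPf wa) (negPf wy).
rewrite /f eqxx (negPf ap) eqxx (negPf yp) (negPf ya) eqxx ltn_add2r.
have dup0 : 0 < dist E u p by rewrite lt0n dist_eq0 // eq_sym.
exact: leq_add (leq_add dup0 dua) duy.
Qed.

End Swaps.

(** * Cut vertices *)

Section CutVertices.

Variables (T : finType) (E : {set {set T}}).
Hypotheses (sE : simple_graph E) (conE : connected_graph E).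

(** Adjacency in the graph obtained from [E] by removing the vertex [b]. *)
Definition del (b : T) : rel T :=
  fun x y => [&& adj E x y, x != b & y != b].

(** [b] is a cut vertex that separates one of its neighbours from [a]; this is
    meaningful for [b] distinct from [a] only. *)
Definition cut_from (a b : T) : bool :=
  [exists x, adj E b x && ~~ connect (del b) a x].

Lemma del_sym b x y : del b x y = del b y x.
Proof. by rewrite /del adj_sym [(y != b) && _]andbC. Qed.

Lemma connect_delC b x y : connect (del b) x y = connect (del b) y x.
Proof. exact: (sym_connect_sym (@del_sym b)). Qed.

Lemma del_path_avoid b x p : path (del b) x p -> b \notin p.
Proof.
elim: p x => //= y p IH x /andP[/and3P[_ _ yb] /IH bp].
by rewrite inE negb_or eq_sym yb.
Qed.

Lemma path_del b x p : path (adj E) x p -> b \notin x :: p -> path (del b) x p.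
Proof.
elim: p x => //= y p IH x /andP[xy pP]; rewrite inE negb_or => /andP[bx byp].
rewrite /del xy eq_sym bx IH //= andbT.
by move: byp; rewrite inE negb_or eq_sym => /andP[].
Qed.

Lemma dist_beyond_cut a b z :
  z != b -> ~~ connect (del b) a z -> dist E a b < dist E a z.
Proof.
move=> zb naz; have [p [sp pP lp]] := dist_walk (connected_connect conE a z).
have bp : b \in a :: p.
  apply: contraR naz => nbp; apply/connectP; exists p => //; exact: path_del.
have := dist_split pP bp; rewrite lp sp; apply: leq_trans.
by rewrite -addn1 leq_add2l lt0n dist_eq0 // eq_sym.
Qed.

(** In a cactus, a vertex that is not a cut vertex has degree at most 2: paths
    avoiding [p] from its neighbours [x1] and [x2] to a third neighbour [x3]
    close up into two cycles, which share [p] and [x3] and differ by the edge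
    [p x1]. *)
Lemma cactus_not_cut_deg2 a p x1 x2 x3 :
  cactus E -> p != a -> ~~ cut_from a p ->
  adj E p x1 -> adj E p x2 -> x1 != x2 ->
  adj E p x3 -> x3 = x1 \/ x3 = x2.
Proof.
move=> [_ cac] pa /existsPn ncut px1 px2 x12 px3.
have [-> | x13] := eqVneq x3 x1; first by left.
have [-> | x23] := eqVneq x3 x2; first by right.
rewrite eq_sym in x13; rewrite eq_sym in x23; exfalso.
have ax x : adj E p x -> connect (del p) a x.
  by move=> px; have := ncut x; rewrite px negbK.
have cyc x : adj E p x -> x != x3 -> exists q,
    [/\ simple_cycle E (p :: x :: q), x3 \in q & last x q = x3].
  move=> px xx3; have : connect (del p) x x3.
    by apply: connect_trans (ax _ px3); rewrite connect_delC ax.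
  case/connectP => q0 qP0 x3E; case: (shortenP qP0) x3E => q qP uq _ x3E.
  have pq := del_path_avoid qP.
  have x3q : x3 \in q.
    by have := mem_last x q; rewrite -x3E inE eq_sym (negPf xx3).
  exists q; split=> //; rewrite /simple_cycle; apply/and3P; split.
  - by case: (q) x3q.
  - by rewrite cons_uniq uq inE negb_or pq (adj_neq sE px).
  - rewrite /= px rcons_path -x3E adj_sym px3 andbT.
    by apply: sub_path qP => u v /and3P[].
have [q1 [c1 x3q1 l1]] := cyc x1 px1 x13.
have [q2 [c2 x3q2 l2]] := cyc x2 px2 x23.
have ne : cycle_edges (p :: x1 :: q1) <> cycle_edges (p :: x2 :: q2).
  move/setP/(_ [set p; x1]); rewrite [LHS](_ : _ = true); last first.
    by apply/imsetP; exists p; rewrite ?inE ?eqxx //= eqxx.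
  move/esym/imsetP => [x xc /setP e].
  have /and3P[_ uc _] := c2.
  have [xp | xp] := eqVneq x p.
    have := e x1; rewrite xp /= eqxx !inE eqxx orbT (negPf x12) orbF.
    by rewrite eq_sym (negPf (adj_neq sE px1)).
  have pn : p = next (p :: x2 :: q2) x.
    by have := e p; rewrite !inE eqxx [p == x]eq_sym (negPf xp) => /esym/eqP.
  have xx1 : x = x1.
    by have := e x; rewrite !inE eqxx (negPf xp) => /eqP.
  have := prev_next uc x; rewrite -pn xx1 => p1.
  (* The neighbours of [p] on the second cycle are [x2] and [x3]. *)
  have : prev (p :: x2 :: q2) p = x3.
    have px2q : p \notin x2 :: q2 by case/andP: uc.
    rewrite prev_nth mem_head (memNindex px2q).
    by rewrite -[size _]/(size (p :: x2 :: q2)).-1 nth_last.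
  by rewrite p1 => x13E; rewrite x13E eqxx in x13.
have := cac _ _ c1 c2 ne; apply/negP; rewrite -ltnNge.
have -> : 2 = #|[set p; x3]| by rewrite cards2 (adj_neq sE px3).
apply/subset_leq_card/subsetP => z; rewrite !inE.
by case/orP=> /eqP ->; rewrite ?eqxx // x3q1 x3q2 !orbT.
Qed.

End CutVertices.

(** * Cut vertices of an equilibrium cactus *)

Section Equilibrium.

Variables (T : finType) (E : {set {set T}}).
Hypotheses (sE : simple_graph E) (eqE : sum_basic_equilibrium E).
Let conE : connected_graph E := eqE.1.

(** Let [x] be separated from [a] by its neighbour [b], and let each other
    neighbour of [x] be joined to [x] and [b] only.  That replacing [xb] by
    [xa] does not profit [x] forces [b] to have a smaller distance sum than
    [a]. *)
Lemma hanging_neighbour_gain a b x :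
  b != a -> adj E b x -> ~~ connect (del E b) a x ->
  (forall t, adj E x t -> t != b ->
     adj E b t /\ forall z, adj E t z -> z = x \/ z = b) ->
  \sum_w dist E b w < \sum_w dist E a w.
Proof.
move=> ba bx nax hang; have xb : x != b by rewrite eq_sym (adj_neq sE bx).
have ax : a != x by apply: contraNneq nax => <-; exact: connect0.
have dab : 0 < dist E a b by rewrite lt0n dist_eq0 // eq_sym.
(* The neighbours of [x] other than [b]: the swap keeps them adjacent to [x]. *)
pose S w := adj E x w && (w != b).
have far w : S w -> dist E a b < dist E a w.
  case/andP=> xw wb; apply: dist_beyond_cut => //; apply: contra nax => aw.
  by apply: connect_trans aw (connect1 _); rewrite /del adj_sym xw wb.
have dax : dist E a b < dist E a x by apply: dist_beyond_cut.
have through_b v : v != x -> ~~ S v -> dist E b v < dist E x v.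
  move=> vx Sv; have [[|t r] [<- /= rP lr ur]] := dist_walk_uniq conE x v.
    by rewrite -lr eqxx in vx.
  case/andP: rP => xt rP; have [tb | tb] := eqVneq t b.
    by rewrite ltnS -lr tb dist_min // -tb.
  case: r => [|s r] in rP lr ur *.
    by rewrite -lr /= in Sv; rewrite /S xt tb in Sv.
  case/andP: rP => ts rP; have [sx | sb] := (hang t xt tb).2 s ts.
    by rewrite sx /= !inE eqxx orbT in ur.
  by have := dist_min rP; rewrite -lr /= sb => le_r; exact: leqW le_r.
(* A shortest walk from [a] to a vertex outside [S] other than [x] does not meet
   [x], so that it survives the swap. *)
pose f w := if S w then 1 else (dist E a w).+1.
have walks w : w != x -> exists p,
    [/\ path (adj (swap E x b a)) x p, last x p = w & size p <= f w].
  move=> wx; rewrite /f; case: ifPn => Sw.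
    by exists [:: w]; case/andP: Sw => xw wb; rewrite /= adj_swap_center.
  have [p [sp pP lp]] := dist_walk (connected_connect conE a w).
  exists (a :: p); rewrite /= adj_swap_new sp; split=> //=.
  rewrite path_swap_away //; apply/negP => xp.
  have := dist_split pP xp; rewrite lp sp leqNgt => /negP; apply.
  apply: leq_ltn_trans (dist_triangle conE b _ _) _.
  by rewrite -addSn leq_add // ltnW // through_b.
have xb' : adj E x b by rewrite adj_sym.
have ab : a != b by rewrite eq_sym.
have le_f := equilibrium_swap eqE xb' ax ab walks.
(* The strict inequality comes from the summand of [x]: [b] is adjacent to [x]
   while [a] is not. *)
rewrite (bigD1 x) //= [ltnRHS](bigD1 x) //= -addSn leq_add //.
  by apply: leq_trans dax; rewrite ltnS (leq_trans (dist_adj bx)).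
rewrite -(leq_add2r (\sum_(w | w != x) f w)).
apply: leq_trans (leq_add (leqnn _) le_f); rewrite -!big_split /=.
apply: leq_sum => w wx; rewrite /f; case: ifPn => Sw.
  have /andP[xw wb] := Sw; rewrite addn1.
  apply: leq_trans (leq_addr _ _); apply: leq_trans (far w Sw).
  by rewrite ltnS (leq_trans (dist_adj (hang w xw wb).1)).
by rewrite addnS -addSn addnC leq_add2l through_b.
Qed.

Lemma median_not_cut a b :
  cactus E -> (forall v, \sum_w dist E a w <= \sum_w dist E v w) ->
  b != a -> ~~ cut_from E a b.
Proof.
move=> cac med ba; apply/negP => cutb.
pose P c := (c != a) && cut_from E a c.
have Pb : P b by rewrite /P ba.
case: (@arg_maxnP _ b P (dist E a) Pb) => {ba cutb Pb}b /andP[ba] + bmax.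
case/existsP => x /andP[bx nax].
have beyond z : z != b -> ~~ connect (del E b) a z ->
    z != a /\ ~~ cut_from E a z.
  move=> zb naz; have za : z != a.
    by apply: contraNneq naz => ->; exact: connect0.
  split=> //; apply/negP => cz; have /bmax : P z by rewrite /P za.
  by apply/negP; rewrite /= -ltnNge dist_beyond_cut.
have xb : x != b by rewrite eq_sym (adj_neq sE bx).
have deg2 z : z != b -> ~~ connect (del E b) a z -> forall t1 t2 t3,
    adj E z t1 -> adj E z t2 -> t1 != t2 -> adj E z t3 -> t3 = t1 \/ t3 = t2.
  move=> zb naz t1 t2 t3 z1 z2 t12 z3; have [za nz] := beyond z zb naz.
  exact: (cactus_not_cut_deg2 sE cac za nz z1 z2 t12 z3).
have xb' : adj E x b by rewrite adj_sym.
have beyond_adj t : adj E x t -> t != b -> ~~ connect (del E b) a t.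
  move=> xt tb; apply: contra nax => cat; apply: connect_trans cat (connect1 _).
  by rewrite /del adj_sym xt tb.
suff hang t : adj E x t -> t != b ->
    adj E b t /\ forall z, adj E t z -> z = x \/ z = b.
  by have := med b; rewrite leqNgt (hanging_neighbour_gain ba bx nax hang).
move=> xt tb; have ncat := beyond_adj t xt tb.
suff bt : adj E b t.
  by split=> // z; apply: deg2; rewrite // adj_sym.
(* A neighbour [t] of [x] not adjacent to [b] would start a shortest path
   [t, x, b, y], where [y] is the neighbour of [b] on a shortest path to [a]. *)
apply: contraT => nbt.
have [y [yb b_y ay]] : exists y, [/\ y != b, adj E b y & connect (del E b) a y].
  have [p [_ pP lp up]] := dist_walk_uniq conE a b.
  case: (lastP p) pP lp up => [|q b'] pP lp up; first by rewrite -lp eqxx in ba.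
  rewrite last_rcons in lp; move: pP up.
  rewrite lp rcons_path -rcons_cons rcons_uniq.
  case/andP=> qP yb /andP[bq _]; exists (last a q); split; last 1 first.
  - by apply/connectP; exists q => //; apply: path_del.
  - exact: adj_neq yb.
  - by rewrite adj_sym.
have dty : 2 < dist E t y.
  rewrite ltnNge; apply/negP => le2.
  have [r [sr rP lr]] := dist_walk (connected_connect conE t y).
  have br : b \notin t :: r.
    rewrite -sr in le2; case: r => [|z [|w [|//]]] /= in rP lr le2 {sr} *.
    + by rewrite inE eq_sym.
    + by rewrite lr !inE ![b == _]eq_sym negb_or tb.
    + rewrite lr !inE ![b == _]eq_sym !negb_or tb yb andbT /=.
      case/andP: rP => tz _; apply: contraNneq nbt => <-; by rewrite adj_sym.
  move: ncat; rewrite (connect_trans ay) //= connect_delC.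
  by apply/connectP; exists r => //; apply: path_del.
have tx : adj E t x by rewrite adj_sym.
case: (no_degree2_on_long_path sE eqE tx xb' b_y _ dty) => z.
exact: deg2.
Qed.

End Equilibrium.

Theorem theorem10 (T : finType) (E : {set {set T}}) :
  simple_graph E -> sum_basic_equilibrium E -> cactus E -> diameter E <= 2.
Proof.
move=> sE eqE cac; have conE := eqE.1.
apply/bigmax_leqP => x _; apply/bigmax_leqP => w _.
rewrite leqNgt; apply/negP => dxw.
case: (@arg_minnP _ x xpredT (fun v => \sum_w dist E v w) isT) => a _ med.
have deg2 p t1 t2 t3 : p != a -> adj E p t1 -> adj E p t2 -> t1 != t2 ->
    adj E p t3 -> t3 = t1 \/ t3 = t2.
  move=> pa p1 p2 t12 p3.
  have ncut : ~~ cut_from E a p.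
    by apply: median_not_cut => // v; exact: med.
  exact: (cactus_not_cut_deg2 sE cac pa ncut p1 p2 t12 p3).
have [r [sr rP lr]] := dist_walk (connected_connect conE x w).
case: r => [|p [|q [|y r]]] in sr rP lr; rewrite -sr // in dxw.
case/and4P: rP => xp pq qy rP.
have dxy : 2 < dist E x y.
  have := dist_triangle conE y x w; rewrite -sr -lr /= => tri.
  have := leq_trans tri (leq_add (leqnn _) (dist_min rP)).
  by rewrite -addn3 addnC leq_add2r.
have px : adj E p x by rewrite adj_sym.
have qp : adj E q p by rewrite adj_sym.
have yq : adj E y q by rewrite adj_sym.
have xq : x != q.
  apply: contraTneq dxy => ->; by rewrite -leqNgt ltnW // ltnS dist_adj.
have py : p != y.
  apply: contraTneq dxy => <-; by rewrite -leqNgt ltnW // ltnS dist_adj.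
have [pa | pa] := eqVneq p a; last first.
  by apply: (no_degree2_on_long_path sE eqE xp pq qy _ dxy) => z; apply: deg2.
have qa : q != a by rewrite -pa eq_sym (adj_neq sE pq).
apply: (no_degree2_on_long_path sE eqE yq qp px); last by rewrite distC.
by move=> z; apply: deg2 => //; rewrite eq_sym.
Qed.
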